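(* Let $Q$ be a quandle, let $n\ge1$, and let $g_1^{+},g_1^{-},g_2^{+},g_2^{-}:Q\times Q\to M_n(\mathbb{C}[t^{\pm1}])$ be maps. The following are equivalent: 1. $g=(g_1^+,g_1^-,g_2^+,g_2^-)$ preserves holonomy, that is, conditions (A), (B) and (C) stated in the context hold. 2. $g=(g_1^+,g_1^-,g_2^+,g_2^-)$ is an $f$-twisted Alexander weight, i.e. it is the $f$-twisted weight of some pair $f=(f_1,f_2)$ of maps $Q\times Q\to M_n(\mathbb{C}[t^{\pm1}])$ satisfying the Alexander pair conditions on realizable elements.
   Context: **Quandles.** A quandle is a non-empty set $Q$ with an operation $*$ such that $a*a=a$ for all $a$; for every $b$ the map $a\mapsto a*b$ is bijective, with inverse written $a\mapsto a*^{-1}b$; and $(a*b)*c=(a*c)*(b*c)$ for all $a,b,c$. For an oriented knot $K$, $Q(K)$ is its knot quandle, generated by the arcs of a diagram: if an arc $x_i$ passes under the over-arc $x_j$ and becomes $x_{i+1}$, then $x_{i+1}=x_i*x_j$ at a positive crossing and $x_{i+1}=x_i*^{-1}x_j$ at a negative crossing. **Realizable elements.** A tuple of elements of $Q$ (a single element, pair or triple) is realizable if there are an oriented knot $K$ and a quandle homomorphism $\rho:Q(K)\to Q$ such that all its entries lie in $\rho(Q(K))$. All conditions below are required for all realizable $a$, $(a,b)$, $(a,b,c)$ respectively. **Weights at crossings.** In the graph of a diagram coloured by $\rho$, with $X_i=\rho(x_i)$, each crossing where $x_i$ passes under $x_j$ and becomes $x_{i+1}$ gives an edge from $v_i$ to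 $v_{i+1}$ of weight $g_1^{\pm}(X_i,X_j)$ and an edge from $v_i$ to $v_j$ of weight $g_2^{\pm}(X_i,X_j)$, with sign that of the crossing. **Holonomy preservation.** $g$ preserves holonomy if the following hold (they express equality of sums of path weights before and after the Reidemeister moves 1, 2 and 3): (A) $g_1^-(a,a)+g_2^-(a,a)=1$. (B) $g_1^-(a,b)\,g_1^+(a*^{-1}b,b)=1$; $\ g_1^+(a,b)\,g_1^-(a*b,b)=1$; $\ g_2^-(a,b)+g_1^-(a,b)\,g_2^+(a*^{-1}b,b)=0$; $\ g_2^+(a,b)+g_1^+(a,b)\,g_2^-(a*b,b)=0$. (C) $g_1^+(a,b)\,g_1^+(a*b,c)=g_1^+(a,c)\,g_1^+(a*c,b*c)$; $\ g_2^+(a,b)\,g_1^+(b,c)=g_1^+(a,c)\,g_2^+(a*c,b*c)$; $\ g_1^+(a,b)\,g_2^+(a*b,c)+g_2^+(a,b)\,g_2^+(b,c)=g_2^+(a,c)$. **Alexander pair conditions** for $f_1,f_2:Q\times Q\to M_n(\mathbb{C}[t^{\pm1}])$: - $f_1(a,a)+f_2(a,a)=1$; - $f_1(a,b)$ is invertible; - $f_1(a*b,c)f_1(a,b)=f_1(a*c,b*c)f_1(a,c)$; - $f_1(a*b,c)f_2(a,b)=f_2(a*c,b*c)f_1(b,c)$; - $f_2(a*b,c)=f_1(a*c,b*c)f_2(a,c)+f_2(a*c,b*c)f_2(b,c)$. **$f$-twisted weight.** If $f=(f_1,f_2)$ satisfies the Alexander pair conditions for all realizable elements, the $f$-twisted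 (Alexander) weight is given on realizable pairs by $$g_1^+(a,b)=f_1(a,b)^{-1},\quad g_2^+(a,b)=-f_1(a,b)^{-1}f_2(a,b),\quad g_1^-(a,b)=f_1(a*^{-1}b,b),\quad g_2^-(a,b)=f_2(a*^{-1}b,b).$$ *)

(* Defs.v *)
From HB Require Import structures.
From mathcomp Require Import all_boot all_order all_algebra.
From mathcomp Require Import boolp classical_sets reals.
From mathcomp Require Import complex.

Set Implicit Arguments.
Unset Strict Implicit.
Unset Printing Implicit Defensive.

Import GRing.Theory.
Local Open Scope ring_scope.

(** * Laurent polynomials *)

(* F[t, t^-1] is the localization of F[t] at t, taken inside the field of
   fractions F(t): the fractions p / t^k. *)
Definition is_laurent (F : fieldType) : {pred {fraction {poly F}}} :=
  fun x => `[< exists (p : {poly F}) (k : nat),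
                 x = tofrac p / tofrac 'X ^+ k >].

Section LaurentRing.
Variable F : fieldType.

Fact laurent_subring_closed : subring_closed (@is_laurent F).
Proof.
have tX k : tofrac ('X : {poly F}) ^+ k != 0.
  by rewrite expf_neq0 // tofrac_eq0 polyX_eq0.
split=> [|x y /asboolP[p [k ->]] /asboolP[q [l ->]]|
         x y /asboolP[p [k ->]] /asboolP[q [l ->]]]; apply/asboolP.
- by exists 1, 0; rewrite tofrac1 expr0 divr1.
- exists (p * 'X^l - q * 'X^k), (k + l)%N.
  rewrite tofracB !tofracM !tofracXn exprD mulrBl.
  by rewrite [in X in _ = _ - X](mulrC (_ ^+ k)) -!mulf_div !divff // !mulr1.
- by exists (p * q), (k + l)%N; rewrite tofracM exprD mulf_div.
Qed.

HB.instance Definition _ :=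
  GRing.isSubringClosed.Build _ (@is_laurent F) laurent_subring_closed.

Record laurent := Laurent {
  laurent_val :> {fraction {poly F}};
  _ : laurent_val \in @is_laurent F }.

HB.instance Definition _ := [isSub for laurent_val].
HB.instance Definition _ := [Choice of laurent by <:].
HB.instance Definition _ := [SubChoice_isSubComNzRing of laurent by <:].

Definition laurent_unit : {pred laurent} :=
  fun x => (val x != 0) && ((val x)^-1 \in @is_laurent F).

(* [insubd x] falls back on [x] when the inverse is not a Laurent polynomial,
   as required of [^-1] on nonunits. *)
Definition laurent_inv (x : laurent) : laurent := insubd x (val x)^-1.

Fact laurent_mulVr : {in laurent_unit, left_inverse 1 laurent_inv *%R}.
Proof.
move=> x /andP[x0 Vx]; apply: val_inj.
by rewrite rmorphM rmorph1 /= insubdK // mulVf.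
Qed.

Fact laurent_unitP (x y : laurent) : y * x = 1 -> x \in laurent_unit.
Proof.
move=> /(congr1 val); rewrite rmorphM rmorph1 /= => yx1.
have x0 : val x != 0.
  by apply/eqP => x0; move/eqP: yx1; rewrite x0 mulr0 eq_sym oner_eq0.
apply/andP; split=> //.
suff -> : (val x)^-1 = val y by exact: valP.
by apply: (mulIf x0); rewrite mulVf.
Qed.

Fact laurent_invr_out : {in [predC laurent_unit], laurent_inv =1 id}.
Proof.
move=> x; rewrite inE negb_and negbK => /orP[/eqP x0|Vx]; apply: val_inj.
  by rewrite val_insubd x0 invr0; case: ifP.
by rewrite val_insubd (negPf Vx).
Qed.

HB.instance Definition _ := GRing.ComNzRing_hasMulInverse.Build laurent
  laurent_mulVr laurent_unitP laurent_invr_out.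

End LaurentRing.

(** * Quandles *)

Record quandle := Quandle {
  qcarrier :> Type;
  qop : qcarrier -> qcarrier -> qcarrier;
  qcarrier_inhabited : inhabited qcarrier;
  qop_idem : forall a, qop a a = a;
  qop_bij : forall b, bijective (fun a => qop a b);
  qop_dist : forall a b c, qop (qop a b) c = qop (qop a c) (qop b c) }.

Declare Scope quandle_scope.
Delimit Scope quandle_scope with qd.
Local Open Scope quandle_scope.

Notation "a ** b" := (qop a b) (at level 40, left associativity)
  : quandle_scope.

Fact qop_inv_subproof (Q : quandle) (b : Q) :
  exists f : Q -> Q, cancel (fun a => a ** b) f /\ cancel f (fun a => a ** b).
Proof. by case: (qop_bij b) => f fK Kf; exists f. Qed.

Definition qinv (Q : quandle) (a b : Q) : Q :=
  sval (cid (qop_inv_subproof b)) a.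

Notation "a **^-1 b" := (qinv a b) (at level 40, left associativity)
  : quandle_scope.

Lemma qopK (Q : quandle) (b : Q) :
  cancel (fun a => a ** b) (fun a => a **^-1 b).
Proof. by rewrite /qinv; case: cid => f []. Qed.

Lemma qinvK (Q : quandle) (b : Q) :
  cancel (fun a => a **^-1 b) (fun a => a ** b).
Proof. by rewrite /qinv; case: cid => f []. Qed.

Definition quandle_hom (P Q : quandle) (rho : P -> Q) : Prop :=
  {morph rho : a b / a ** b}.

(** * Quandles given by generators and relations *)

Inductive qterm (A : Type) : Type :=
  | QGen of A
  | QOp of qterm A & qterm A
  | QInv of qterm A & qterm A.

HB.instance Definition _ (A : Type) := gen_eqMixin (qterm A).
HB.instance Definition _ (A : Type) := gen_choiceMixin (qterm A).

Inductive qcong (A : Type) (rel : qterm A -> qterm A -> Prop) :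
    qterm A -> qterm A -> Prop :=
  | qcong_rel a b : rel a b -> qcong rel a b
  | qcong_refl a : qcong rel a a
  | qcong_sym a b : qcong rel a b -> qcong rel b a
  | qcong_trans a b c : qcong rel a b -> qcong rel b c -> qcong rel a c
  | qcong_op a a' b b' : qcong rel a a' -> qcong rel b b' ->
      qcong rel (QOp a b) (QOp a' b')
  | qcong_inv a a' b b' : qcong rel a a' -> qcong rel b b' ->
      qcong rel (QInv a b) (QInv a' b')
  | qcong_idem a : qcong rel (QOp a a) a
  | qcong_opK a b : qcong rel (QInv (QOp a b) b) a
  | qcong_invK a b : qcong rel (QOp (QInv a b) b) a
  | qcong_dist a b c :
      qcong rel (QOp (QOp a b) c) (QOp (QOp a c) (QOp b c)).

Section PresentedQuandle.
Variables (A : Type) (A_inhabited : inhabited A).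
Variable rel : qterm A -> qterm A -> Prop.

Local Open Scope quotient_scope.

Definition qcongb (a b : qterm A) : bool := `[< qcong rel a b >].

Fact qcongb_equiv : equiv_class_of qcongb.
Proof.
split=> [a|a b|b a c].
- by apply/asboolP; exact: qcong_refl.
- by apply/asboolP/asboolP; exact: qcong_sym.
- by move=> /asboolP ab /asboolP bc; apply/asboolP; exact: qcong_trans bc.
Qed.

Canonical qcongb_equivRel := EquivRelPack qcongb_equiv.

Definition presented_type := {eq_quot qcongb}.

Definition presented_op (x y : presented_type) : presented_type :=
  \pi_presented_type (QOp (repr x) (repr y)).

Definition presented_inv (x y : presented_type) : presented_type :=
  \pi_presented_type (QInv (repr x) (repr y)).

Fact presented_pi (a b : qterm A) :
  \pi_presented_type a = \pi_presented_type b <-> qcong rel a b.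
Proof. by split=> [/eqquotP/asboolP | ab] //; apply/eqquotP/asboolP. Qed.

Fact presented_repr (a : qterm A) : qcong rel (repr (\pi_presented_type a)) a.
Proof. by apply/presented_pi; rewrite reprK. Qed.

Fact presented_inhabited : inhabited presented_type.
Proof. by case: A_inhabited => a; split; exact: \pi_presented_type (QGen a). Qed.

Fact presented_idem (x : presented_type) : presented_op x x = x.
Proof.
by rewrite -[RHS]reprK; apply/presented_pi; exact: qcong_idem.
Qed.

Fact presented_bij (y : presented_type) : bijective (presented_op^~ y).
Proof.
exists (presented_inv^~ y) => x; rewrite -[RHS]reprK; apply/presented_pi.
- apply: qcong_trans (qcong_opK _ (repr x) (repr y)).
  by apply: qcong_inv; [exact: presented_repr | exact: qcong_refl].
- apply: qcong_trans (qcong_invK _ (repr x) (repr y)).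
  by apply: qcong_op; [exact: presented_repr | exact: qcong_refl].
Qed.

Fact presented_dist (x y z : presented_type) :
  presented_op (presented_op x y) z =
  presented_op (presented_op x z) (presented_op y z).
Proof.
apply/presented_pi.
apply: (@qcong_trans _ _ _ (QOp (QOp (repr x) (repr y)) (repr z))).
  by apply: qcong_op; [exact: presented_repr | exact: qcong_refl].
apply: qcong_trans (qcong_dist _ _ _ _) _.
by apply: qcong_op; apply: qcong_sym; exact: presented_repr.
Qed.

Definition presented_quandle : quandle :=
  @Quandle presented_type presented_op presented_inhabited presented_idem
    presented_bij presented_dist.

End PresentedQuandle.

(** * Oriented knot diagrams *)

(* An oriented one-component diagram with [n] crossings, recorded as a signed
   Gauss diagram.  Following the orientation from a base point, one meets each
   crossing twice; the [2n] passages are numbered in this order.  [mate i] is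
   the other passage through the same crossing, [over i] tells whether the
   passage [i] is on the over-strand, [positive i] is the crossing sign. *)
Record gauss_diagram := GaussDiagram {
  ncross : nat;
  mate : 'I_ncross.*2 -> 'I_ncross.*2;
  over : pred 'I_ncross.*2;
  positive : pred 'I_ncross.*2;
  mateK : involutive mate;
  over_mate : forall i, over (mate i) = ~~ over i;
  positive_mate : forall i, positive (mate i) = positive i }.

Section GaussDiagram.
Variable D : gauss_diagram.

(* The underlying 4-valent graph, as a combinatorial map.  [(i, true)] is the
   half-edge leaving passage [i] and [(i, false)] the half-edge arriving at
   it. *)
Definition dart : Type := ('I_(ncross D).*2 * bool)%type.

Definition edge (x : dart) : dart :=
  if x.2 then (ordS x.1, false) else (ord_pred x.1, true).

(* Counterclockwise rotation about a crossing:
   - over-out, under-out, over-in, under-in at a positive crossing;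
   - over-out, under-in, over-in, under-out at a negative crossing. *)
Definition node (x : dart) : dart :=
  (mate x.1, if over x.1 == positive x.1 then x.2 else ~~ x.2).

Definition face (x : dart) : dart := node (edge x).

(* The diagram lies on the sphere: V - E + F = 2, where V, E and F count the
   orbits of [node], [edge] and [face].  The graph is connected because the
   diagram has only one component.  The crossingless circle has no dart, so
   the formula does not apply to it. *)
Definition spherical : Prop :=
  (0 < ncross D)%N ->
  (fcard node predT + fcard face predT = fcard edge predT + 2)%N.

(* A diagram with n > 0 crossings has n arcs x_0, ..., x_(n-1), numbered
   cyclically along the orientation; the crossingless circle has one arc. *)
Definition arc_type : Type := 'I_(ncross D).-1.+1.

(* The arc on which one is just before passage [k], hence just after passage
   [k-1]: its number is the number of underpasses met so far. *)
Definition arc (k : nat) : arc_type :=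
  inZp #|[set j : 'I_(ncross D).*2 | ~~ over j & (j < k)%N]|.

Inductive crossing_rel : qterm arc_type -> qterm arc_type -> Prop :=
  | crossing_pos (i : 'I_(ncross D).*2) : ~~ over i -> positive i ->
      crossing_rel (QGen (arc i.+1)) (QOp (QGen (arc i)) (QGen (arc (mate i))))
  | crossing_neg (i : 'I_(ncross D).*2) : ~~ over i -> ~~ positive i ->
      crossing_rel (QGen (arc i.+1))
        (QInv (QGen (arc i)) (QGen (arc (mate i)))).

End GaussDiagram.

(* Every oriented knot has such a diagram and every such diagram is that of an
   oriented knot.  Without [spherical] one would get virtual knots. *)
Record knot := Knot {
  diagram :> gauss_diagram;
  diagram_spherical : spherical diagram }.

Definition knot_quandle (K : knot) : quandle :=
  presented_quandle (inhabits (ord0 : arc_type K)) (@crossing_rel K).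

(** * Realizable elements *)

Definition realizable (Q : quandle) (A : set Q) : Prop :=
  exists (K : knot) (rho : knot_quandle K -> Q),
    quandle_hom rho /\ (A `<=` range rho)%classic.

(** * Weights *)

Section Weights.
Variables (L : comUnitRingType) (Q : quandle) (n : nat).
Local Notation weight := (Q -> Q -> 'M[L]_n).
Implicit Types a b c : Q.

Definition holonomy_A (g1m g2m : weight) : Prop :=
  forall a, realizable [set a]%classic ->
    g1m a a + g2m a a = 1%:M.

Definition holonomy_B (g1p g1m g2p g2m : weight) : Prop :=
  forall a b, realizable [set a; b]%classic ->
    [/\ g1m a b *m g1p (a **^-1 b) b = 1%:M,
        g1p a b *m g1m (a ** b) b = 1%:M,
        g2m a b + g1m a b *m g2p (a **^-1 b) b = 0 &
        g2p a b + g1p a b *m g2m (a ** b) b = 0].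

Definition holonomy_C (g1p g2p : weight) : Prop :=
  forall a b c, realizable [set a; b; c]%classic ->
    [/\ g1p a b *m g1p (a ** b) c = g1p a c *m g1p (a ** c) (b ** c),
        g2p a b *m g1p b c = g1p a c *m g2p (a ** c) (b ** c) &
        g1p a b *m g2p (a ** b) c + g2p a b *m g2p b c = g2p a c].

Definition preserves_holonomy (g1p g1m g2p g2m : weight) : Prop :=
  [/\ holonomy_A g1m g2m,
      holonomy_B g1p g1m g2p g2m &
      holonomy_C g1p g2p].

Definition alexander_pair (f1 f2 : weight) : Prop :=
  [/\ forall a, realizable [set a]%classic ->
        f1 a a + f2 a a = 1%:M,
      forall a b, realizable [set a; b]%classic ->
        f1 a b \in unitmx &
      forall a b c, realizable [set a; b; c]%classic ->
        [/\ f1 (a ** b) c *m f1 a b = f1 (a ** c) (b ** c) *m f1 a c,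
            f1 (a ** b) c *m f2 a b = f2 (a ** c) (b ** c) *m f1 b c &
            f2 (a ** b) c =
              f1 (a ** c) (b ** c) *m f2 a c + f2 (a ** c) (b ** c) *m f2 b c]].

Definition is_twisted_weight (f1 f2 g1p g1m g2p g2m : weight) : Prop :=
  forall a b, realizable [set a; b]%classic ->
    [/\ g1p a b = invmx (f1 a b),
        g2p a b = - (invmx (f1 a b) *m f2 a b),
        g1m a b = f1 (a **^-1 b) b &
        g2m a b = f2 (a **^-1 b) b].

End Weights.

(* Main.v *)
Require Import Defs.
From mathcomp Require Import all_boot all_order all_algebra.
From mathcomp Require Import boolp classical_sets reals.
From mathcomp Require Import complex.

(** The pair [f] is forced by the weight: the formula for [g1m] and [g2m],
    read at [a ** b], says that [f1 a b] is [g1m (a ** b) b] and [f2 a b] is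
    [g2m (a ** b) b].  For this pair, condition (B) says exactly that
    [f1 a b] is invertible with inverse [g1p a b], and that [g2p] is the
    prescribed combination of [f1] and [f2]; so (B) makes [g] the twisted
    weight of [f], and conversely ([twisted_holonomy_B]).

    Once [g] is the twisted weight of [f], condition (A) is the first
    condition on Alexander pairs because [a **^-1 a = a], and condition (C)
    turns into the three cocycle equations after multiplication on the left
    by [f1 (a ** b) c *m f1 a b] ([twisted_cocycleP]).

    Everything is asked of realizable elements only, whereas the conditions
    also involve [f] and [g] at elements such as [a ** b] or [a **^-1 b].
    These are again realizable, together with [a], [b] and [c], since the image
    of a quandle homomorphism is a subquandle ([realizable_subquandle]). *)

Set Implicit Arguments.
Unset Strict Implicit.
Unset Printing Implicit Defensive.

Import GRing.Theory.
Local Open Scope ring_scope.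
Local Open Scope quandle_scope.

Lemma quandle_hom_qinv (P Q : quandle) (rho : P -> Q) :
  quandle_hom rho -> {morph rho : a b / a **^-1 b}.
Proof. by move=> rhoM a b; rewrite -{2}(qinvK b a) rhoM qopK. Qed.

Lemma qinv_idem (Q : quandle) (a : Q) : a **^-1 a = a.
Proof. by rewrite -{1}(qop_idem a) qopK. Qed.

(** [S] is the image of the homomorphism that realizes [A]. *)
Lemma realizable_subquandle (Q : quandle) (A : set Q) : realizable A ->
  exists S : set Q,
    [/\ (A `<=` S)%classic,
        forall a b, S a -> S b -> S (a ** b),
        forall a b, S a -> S b -> S (a **^-1 b) &
        forall B, (B `<=` S)%classic -> realizable B].
Proof.
case=> K [rho [rhoM sA]]; exists (range rho); split=> //.
- by move=> _ _ [x _ <-] [y _ <-]; exists (x ** y) => //; rewrite rhoM.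
- move=> _ _ [x _ <-] [y _ <-]; exists (x **^-1 y) => //.
  exact: quandle_hom_qinv.
- by move=> B sB; exists K, rho.
Qed.

Section RealizablePairs.
Variable Q : quandle.
Implicit Types a b c : Q.
Local Notation rpair a b := (realizable [set a; b]%classic).

Lemma realizable_diag a : realizable [set a]%classic -> rpair a a.
Proof. by rewrite setUid. Qed.

Lemma realizable_qop a b : rpair a b -> rpair (a ** b) b.
Proof.
move=> /realizable_subquandle[S [sS SM _ Sr]].
have [Sa Sb] : S a /\ S b by split; apply: sS; [left | right].
by apply: Sr => x [] ->; [exact: SM | ].
Qed.

Lemma realizable_qinv a b : rpair a b -> rpair (a **^-1 b) b.
Proof.
move=> /realizable_subquandle[S [sS _ SV Sr]].
have [Sa Sb] : S a /\ S b by split; apply: sS; [left | right].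
by apply: Sr => x [] ->; [exact: SV | ].
Qed.

(** The five pairs at which the third Reidemeister move evaluates a weight. *)
Lemma realizable_triple a b c : realizable [set a; b; c]%classic ->
  [/\ rpair a b, rpair (a ** b) c, rpair a c, rpair (a ** c) (b ** c) &
      rpair b c].
Proof.
move=> /realizable_subquandle[S [sS SM _ Sr]].
have Sa : S a by apply: sS; left; left.
have Sb : S b by apply: sS; left; right.
have Sc : S c by apply: sS; right.
by split; apply: Sr => x [] -> //; exact: SM.
Qed.

End RealizablePairs.

Lemma invmx_mul (L : comUnitRingType) (n : nat) (A B : 'M[L]_n) :
  A \in unitmx -> B \in unitmx -> invmx (A *m B) = invmx B *m invmx A.
Proof.
move=> UA UB; have UAB : A *m B \in unitmx by rewrite unitmx_mul UA.
by apply: (can_inj (mulKmx UAB)); rewrite mulmxV // -mulmxA mulKVmx ?mulmxV.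
Qed.

(** The equivalence at one triple.  The entries stand for the values of a pair
    [f]: [x1], [u1] at [(a, b)]; [x2], [u2] at [(a ** b, c)]; [y1], [v1] at
    [(a, c)]; [y2], [v2] at [(a ** c, b ** c)]; [z], [w] at [(b, c)].
    The first equations are inverse to each other.  The others correspond
    under left multiplication by [x2 *m x1 = y2 *m y1], which clears the
    denominators on both sides. *)
Lemma twisted_cocycleP (L : comUnitRingType) (n : nat)
    (x1 x2 y1 y2 z u1 u2 v1 v2 w : 'M[L]_n) :
    x1 \in unitmx -> x2 \in unitmx -> y1 \in unitmx -> y2 \in unitmx ->
    z \in unitmx ->
  [/\ invmx x1 *m invmx x2 = invmx y1 *m invmx y2,
      - (invmx x1 *m u1) *m invmx z = invmx y1 *m - (invmx y2 *m v2) &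
      invmx x1 *m - (invmx x2 *m u2) +
        - (invmx x1 *m u1) *m - (invmx z *m w) = - (invmx y1 *m v1)] <->
  [/\ x2 *m x1 = y2 *m y1,
      x2 *m u1 = v2 *m z &
      u2 = y2 *m v1 + v2 *m w].
Proof.
move=> Ux1 Ux2 Uy1 Uy2 Uz.
have E1 : invmx x1 *m invmx x2 = invmx y1 *m invmx y2 <->
          x2 *m x1 = y2 *m y1.
  rewrite -!invmx_mul //; split=> [|-> //].
  exact: (can_inj (@invmxK _ _)).
have left_cancel (A B : 'M_n) : x2 *m x1 *m A = x2 *m x1 *m B <-> A = B.
  split=> [|-> //].
  by apply: (can_inj (mulKmx _)); rewrite unitmx_mul Ux2.
have E2 : x2 *m x1 = y2 *m y1 ->
    - (invmx x1 *m u1) *m invmx z = invmx y1 *m - (invmx y2 *m v2) <->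
    x2 *m u1 = v2 *m z.
  (* The factor [x2 *m x1] is kept where [invmx x1] follows and becomes
     [y2 *m y1] where [invmx y1] does. *)
  move=> e1; rewrite -[X in X <-> _]left_cancel {2}e1 mulmxN mulNmx !mulmxN -!mulmxA.
  rewrite !mulKVmx //; split=> [/oppr_inj <-|e2].
    by rewrite mulmxA mulmxKV.
  by rewrite mulmxA e2 mulmxK.
have E3 : x2 *m x1 = y2 *m y1 -> x2 *m u1 = v2 *m z ->
    invmx x1 *m - (invmx x2 *m u2) +
      - (invmx x1 *m u1) *m - (invmx z *m w) = - (invmx y1 *m v1) <->
    u2 = y2 *m v1 + v2 *m w.
  move=> e1 e2; rewrite -[X in X <-> _]left_cancel mulmxDr {3}e1.
  rewrite mulNmx !mulmxN opprK -!mulmxA !mulKVmx // [x2 *m _]mulmxA e2.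
  rewrite -mulmxA mulKVmx //; split=> [|->]; last first.
    by rewrite opprD addrNK.
  by move/(canRL (addrK _))/(canRL opprK); rewrite opprD !opprK.
split=> [[/E1 e1 /(E2 e1) e2 /(E3 e1 e2) e3] | [e1 e2 e3]]; split=> //.
- exact/E1.
- exact/(E2 e1).
- exact/(E3 e1 e2).
Qed.

Section TwistedWeight.
Variables (L : comUnitRingType) (Q : quandle) (n : nat).
Variables f1 f2 g1p g1m g2p g2m : Q -> Q -> 'M[L]_n.
Hypothesis f1_unit :
  forall a b, realizable [set a; b]%classic -> f1 a b \in unitmx.
Hypothesis gE : is_twisted_weight f1 f2 g1p g1m g2p g2m.

Lemma twisted_holonomy_A :
  holonomy_A g1m g2m <->
  (forall a, realizable [set a]%classic -> f1 a a + f2 a a = 1%:M).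
Proof.
have E a : realizable [set a]%classic ->
    g1m a a + g2m a a = f1 a a + f2 a a.
  by case/realizable_diag/gE => _ _ -> ->; rewrite qinv_idem.
by split=> H a ra; move: (H a ra); rewrite E.
Qed.

Lemma twisted_holonomy_B : holonomy_B g1p g1m g2p g2m.
Proof.
move=> a b rab.
have [g1pE g2pE g1mE g2mE] := gE rab.
have [_ _ g1mE' g2mE'] := gE (realizable_qop rab).
have rVab := realizable_qinv rab.
have [g1pE' g2pE' _ _] := gE rVab.
rewrite g1pE g2pE g1mE g2mE g1mE' g2mE' g1pE' g2pE' qopK.
split; first by rewrite mulmxV ?f1_unit.
- by rewrite mulVmx ?f1_unit.
- by rewrite mulmxN mulKVmx ?subrr ?f1_unit.
- by rewrite addNr.
Qed.

Lemma twisted_holonomy_C :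
  holonomy_C g1p g2p <->
  (forall a b c, realizable [set a; b; c]%classic ->
    [/\ f1 (a ** b) c *m f1 a b = f1 (a ** c) (b ** c) *m f1 a c,
        f1 (a ** b) c *m f2 a b = f2 (a ** c) (b ** c) *m f1 b c &
        f2 (a ** b) c =
          f1 (a ** c) (b ** c) *m f2 a c + f2 (a ** c) (b ** c) *m f2 b c]).
Proof.
split=> H a b c rabc; have {H} := H a b c rabc;
  have [r1 r2 r3 r4 r5] := realizable_triple rabc;
  have [-> -> _ _] := gE r1; have [-> -> _ _] := gE r2;
  have [-> -> _ _] := gE r3; have [-> -> _ _] := gE r4;
  have [-> -> _ _] := gE r5;
  by apply twisted_cocycleP; exact: f1_unit.
Qed.

Lemma twisted_preserves_holonomy :
  preserves_holonomy g1p g1m g2p g2m <-> alexander_pair f1 f2.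
Proof.
split=> [[hA _ hC]|[hA _ hC]]; split=> //.
- exact/twisted_holonomy_A.
- exact/twisted_holonomy_C.
- exact/twisted_holonomy_A.
- exact: twisted_holonomy_B.
- exact/twisted_holonomy_C.
Qed.

End TwistedWeight.

(** The second equation of (B) gives [f1 a b] a left inverse only; it is a
    two-sided inverse because the matrices are square over a commutative
    ring. *)
Lemma holonomy_B_twisted (L : comUnitRingType) (Q : quandle) (n : nat)
    (g1p g1m g2p g2m : Q -> Q -> 'M[L]_n) :
    holonomy_B g1p g1m g2p g2m ->
  let f1 a b := g1m (a ** b) b in
  let f2 a b := g2m (a ** b) b in
  (forall a b, realizable [set a; b]%classic -> f1 a b \in unitmx) /\
  is_twisted_weight f1 f2 g1p g1m g2p g2m.
Proof.
move=> hB f1 f2.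
have f1_inv a b : realizable [set a; b]%classic ->
    f1 a b \in unitmx /\ g1p a b = invmx (f1 a b).
  case/hB=> _ g1pK _ _; have [_ Uf1] := mulmx1_unit g1pK.
  by split=> //; rewrite -[LHS](mulmxK Uf1) g1pK mul1mx.
split=> [a b /f1_inv[] // | a b rab].
have [_ <-] := f1_inv a b rab; rewrite /f1 /f2 qinvK; split=> //.
by have [_ _ _ /eqP] := hB a b rab; rewrite addr_eq0 => /eqP.
Qed.

Theorem theorem1p4 (R : realType) (Q : quandle) (n : nat) (n_gt0 : (0 < n)%N)
    (g1p g1m g2p g2m : Q -> Q -> 'M[laurent R[i]]_n) :
  preserves_holonomy g1p g1m g2p g2m <->
  (exists f1 f2 : Q -> Q -> 'M[laurent R[i]]_n,
     alexander_pair f1 f2 /\ is_twisted_weight f1 f2 g1p g1m g2p g2m).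
Proof.
split=> [hg | [f1 [f2 [hf gE]]]].
- have [_ hB _] := hg; have [Uf gE] := holonomy_B_twisted hB.
  eexists; eexists; split; last exact: gE.
  exact/(twisted_preserves_holonomy Uf gE).
- have [_ Uf _] := hf.
  exact/(twisted_preserves_holonomy Uf gE).
Qed.
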